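(* Let $\mathbb{X}$ be a weakly globular double category with a horizontal arrow $f\colon A\to B$. Then the arrow $f\colon\bar A\to\bar B$ in the fundamental bicategory $\mathbf{Bic}(\mathbb{X})$ is an (internal) equivalence if and only if $f$ is a precompanion in $\mathbb{X}$.
   Context: A double category $\mathbb{X}$ is an internal category in $\mathbf{Cat}$: $\mathbb{X}_0$ is the category of objects and vertical arrows, $\mathbb{X}_1$ the category of horizontal arrows and double cells (with vertical composition $\cdot$, where $\beta\cdot\alpha$ has $\alpha$ on top); horizontal composition is $\circ$. $\mathrm{Id}_A$, $1_A$ are the horizontal and vertical identity arrows, $\mathrm{id}_v$ the horizontal identity cell on a vertical arrow $v$, $1_f$ the vertical identity cell on a horizontal arrow $f$. $\mathbb{X}$ is *weakly globular* if (i) there is an equivalence of categories $\gamma\colon\mathbb{X}_0\to\mathbb{X}_0^d$, where $\mathbb{X}_0^d$ is the discrete category of connected components of $\mathbb{X}_0$, and (ii) for all $n\ge2$ the induced functor from the $n$-fold $\mathbb{X}_1\times_{\mathbb{X}_0}\cdots\times_{\mathbb{X}_0}\mathbb{X}_1$ to the $n$-fold $\mathbb{X}_1\times_{\mathbb{X}_0^d}\cdots\times_{\mathbb{X}_0^d}\mathbb{X}_1$ is an equivalence. In particular $\mathbb{X}_0$ is a posetal groupoid. A horizontal arrow $f\colon A\to B$ *is a companion* (has a vertical companion) if there are a vertical arrow $v\colon A\to B$ and cells $\psi$ (top $\mathrm{Id}_A$, bottom $f$, left $1_A$, right $v$) and $\chi$ (top $f$, bottom $\mathrm{Id}_B$,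 left $v$, right $1_B$) with $\chi\circ\psi=1_f$ and $\chi\cdot\psi=\mathrm{id}_v$. A horizontal arrow $f$ is a *left precompanion* if there are horizontal arrows $f'\colon A'\to B'$, $r_f\colon B'\to C$ and a vertically invertible double cell with top $f$ and bottom $f'$ such that $r_f\circ f'$ is a companion; a *right precompanion* if there are horizontal arrows $f''\colon A''\to B''$, $l_f\colon D\to A''$ and a vertically invertible double cell with top $f$ and bottom $f''$ such that $f''\circ l_f$ is a companion; a *precompanion* if both. The *fundamental bicategory* $\mathbf{Bic}(\mathbb{X})$: objects are the connected components $\bar A$ of $\mathbb{X}_0$ ($\bar A$ the component of $A$); arrows $\bar A\to\bar B$ are the horizontal arrows $A'\to B'$ of $\mathbb{X}$ with $\bar A'=\bar A$, $\bar B'=\bar B$ (no identifications); 2-cells $f\Rightarrow g$ are double cells of $\mathbb{X}$ with top $f$ and bottom $g$ (vertical sides being the unique ones), with vertical composition as in $\mathbb{X}$. For $f\colon A_1\to B_1$, $g\colon B_2\to C_2$ with $\bar B_1=\bar B_2$, a chosen pseudo-inverse of the equivalence (ii) for $n=2$ gives horizontally composable $f_3\colon A_3\to B_3$, $g_3\colon B_3\to C_3$ and vertically invertible cells $f_3\to f$, $g_3\to g$; the composite of $f$ and $g$ is $g_3\circ f_3$, and horizontal composition of 2-cells is obtained by conjugating with these cells. The identity on $\bar A$ is $\mathrm{Id}_{\mu_0(\bar A)}$ with $\mu_0$ a chosen pseudo-inverse of $\gamma$; associativity and unit isomorphisms are the induced ones. *)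

(* Defs.v *)
From Stdlib Require Import ssreflect Relations.
From Stdlib Require Import FunctionalExtensionality PropExtensionality ProofIrrelevance.

Set Implicit Arguments.
Unset Strict Implicit.
Unset Printing Implicit Defensive.

Reserved Notation "v · u" (at level 40, left associativity).
Reserved Notation "G ∘ F" (at level 40, left associativity).

Record category := Category {
  ob :> Type;
  hom : ob -> ob -> Type;
  idm : forall A, hom A A;
  comp : forall A B C, hom B C -> hom A B -> hom A C;
  comp1m : forall A B (u : hom A B), comp (idm B) u = u;
  compm1 : forall A B (u : hom A B), comp u (idm A) = u;
  compA : forall A B C D (w : hom C D) (v : hom B C) (u : hom A B),
    comp (comp w v) u = comp w (comp v u) }.

Arguments hom {c} A B.
Arguments idm {c} A.
Arguments comp {c A B C} v u.
Notation "v · u" := (comp v u).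

(* An arrow together with its endpoints: [Arrow u = Arrow v] compares arrows
   whose endpoints are equal only propositionally. *)
Record arrow (C : category) := Arrow { asrc : C; atgt : C; ahom : hom asrc atgt }.
Arguments Arrow {C asrc atgt} ahom.

Lemma Arrow_inj (C : category) (A B : C) (u v : hom A B) :
  Arrow u = Arrow v -> u = v.
Proof.
move=> e.
have h : forall a b : arrow C, a = b ->
    forall (p : asrc a = asrc b) (q : atgt a = atgt b),
    eq_rect _ (fun y => hom (asrc b) y)
      (eq_rect _ (fun x => hom x (atgt a)) (ahom a) _ p) _ q = ahom b.
  by move=> a b <- p q; rewrite (proof_irrelevance _ p eq_refl)
    (proof_irrelevance _ q eq_refl).
exact: (h _ _ e eq_refl eq_refl).
Qed.

Lemma Arrow_comp (C : category) (A B D A' B' D' : C)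
    (u : hom A B) (v : hom B D) (u' : hom A' B') (v' : hom B' D') :
  Arrow u = Arrow u' -> Arrow v = Arrow v' -> Arrow (v · u) = Arrow (v' · u').
Proof.
move=> eu ev.
have eA : A = A' := f_equal (@asrc C) eu.
have eB : B = B' := f_equal (@atgt C) eu.
have eD : D = D' := f_equal (@atgt C) ev.
subst A' B' D'.
by rewrite (Arrow_inj eu) (Arrow_inj ev).
Qed.

Record iso (C : category) (A B : C) := Iso {
  iso_hom :> hom A B;
  iso_inv : hom B A;
  iso_homK : iso_inv · iso_hom = idm A;
  iso_invK : iso_hom · iso_inv = idm B }.
Arguments Iso {C A B} _ _ _ _.

Definition isomorphic (C : category) (A B : C) : Prop := inhabited (iso A B).

Definition iso_refl (C : category) (A : C) : iso A A :=
  Iso (idm A) (idm A) (comp1m _) (comp1m _).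

Definition iso_sym (C : category) (A B : C) (a : iso A B) : iso B A :=
  Iso (iso_inv a) a (iso_invK a) (iso_homK a).

Lemma iso_trans_subproof (C : category) (A B D : C) (b : iso B D) (a : iso A B) :
  (iso_inv a · iso_inv b) · (b · a) = idm A.
Proof. by rewrite compA -(compA (iso_inv b)) iso_homK comp1m iso_homK. Qed.

Definition iso_trans (C : category) (A B D : C) (b : iso B D) (a : iso A B) :
    iso A D :=
  Iso (b · a) (iso_inv a · iso_inv b) (iso_trans_subproof b a)
    (iso_trans_subproof (iso_sym a) (iso_sym b)).

Definition iso_of_eq (C : category) (A B : C) (e : A = B) : iso A B :=
  match e with eq_refl => iso_refl A end.

Record functor (C D : category) := Functor {
  fob :> C -> D;
  fmap : forall A B : C, hom A B -> hom (fob A) (fob B);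
  fmap_id : forall A : C, fmap (idm A) = idm (fob A);
  fmap_comp : forall (A B E : C) (v : hom B E) (u : hom A B),
    fmap (v · u) = fmap v · fmap u }.
Arguments Functor {C D} _ _ _ _.
Arguments fmap {C D} f {A B} u.

Lemma functor_ext (C D : category) (F G : functor C D) :
  (forall A : C, F A = G A) ->
  (forall (A B : C) (u : hom A B), Arrow (fmap F u) = Arrow (fmap G u)) ->
  F = G.
Proof.
case: F => Fo Fm F1 F2; case: G => Go Gm G1 G2 /= eo em.
have eo' : Fo = Go by apply: functional_extensionality.
subst Go.
have em' : Fm = Gm.
  apply: functional_extensionality_dep => A.
  apply: functional_extensionality_dep => B.
  apply: functional_extensionality_dep => u.
  exact: Arrow_inj (em A B u).
subst Gm.
by rewrite (proof_irrelevance _ F1 G1) (proof_irrelevance _ F2 G2).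
Qed.

Lemma functor_eq_ob (C D : category) (F G : functor C D) :
  F = G -> forall A : C, F A = G A.
Proof. by move->. Qed.

Lemma functor_eq_map (C D : category) (F G : functor C D) : F = G ->
  forall (A B : C) (u : hom A B), Arrow (fmap F u) = Arrow (fmap G u).
Proof. by move->. Qed.

Lemma Arrow_fmap (C D : category) (F : functor C D) (A B A' B' : C)
    (u : hom A B) (u' : hom A' B') :
  Arrow u = Arrow u' -> Arrow (fmap F u) = Arrow (fmap F u').
Proof.
exact: (f_equal (fun a : arrow C => Arrow (fmap F (ahom a)))).
Qed.

Definition functor_id (C : category) : functor C C :=
  @Functor C C (fun A => A) (fun A B u => u)
    (fun A => eq_refl) (fun A B E v u => eq_refl).

Lemma functor_comp_id (C D E : category) (G : functor D E) (F : functor C D)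
  (A : C) : fmap G (fmap F (idm A)) = idm (G (F A)).
Proof. by rewrite !fmap_id. Qed.

Lemma functor_comp_comp (C D E : category) (G : functor D E) (F : functor C D)
    (A B K : C) (v : hom B K) (u : hom A B) :
  fmap G (fmap F (v · u)) = fmap G (fmap F v) · fmap G (fmap F u).
Proof. by rewrite !fmap_comp. Qed.

Definition functor_comp (C D E : category) (G : functor D E) (F : functor C D) :
    functor C E :=
  @Functor C E (fun A => G (F A)) (fun A B u => fmap G (fmap F u))
    (functor_comp_id G F) (functor_comp_comp G F).
Notation "G ∘ F" := (functor_comp G F).

Lemma functor_compA (C D E K : category) (H : functor E K) (G : functor D E)
  (F : functor C D) : (H ∘ G) ∘ F = H ∘ (G ∘ F).
Proof. exact: functor_ext. Qed.

Lemma functor_comp1 (C D : category) (F : functor C D) : functor_id D ∘ F = F.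
Proof. exact: functor_ext. Qed.

Lemma functor_compr1 (C D : category) (F : functor C D) : F ∘ functor_id C = F.
Proof. exact: functor_ext. Qed.

Definition functor_iso (C D : category) (F : functor C D) (A B : C)
    (a : iso A B) : iso (F A) (F B).
Proof.
refine (Iso (fmap F a) (fmap F (iso_inv a)) _ _).
- by rewrite -fmap_comp iso_homK fmap_id.
- by rewrite -fmap_comp iso_invK fmap_id.
Defined.

Record natural_iso (C D : category) (F G : functor C D) := NaturalIso {
  niso :> forall A : C, iso (F A) (G A);
  niso_natural : forall (A B : C) (u : hom A B),
    niso B · fmap F u = fmap G u · niso A }.

Record pseudo_inverse (C D : category) (F : functor C D) := PseudoInverse {
  pinv :> functor D C;
  pinv_unit : natural_iso (functor_id C) (pinv ∘ F);
  pinv_counit : natural_iso (F ∘ pinv) (functor_id D) }.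

Section Pullback.
Variables (C D E : category) (F : functor C E) (G : functor D E).

Record pullback_ob := PullbackOb {
  pb1 : C; pb2 : D; pb_ob_eq : F pb1 = G pb2 }.

Record pullback_hom (x y : pullback_ob) := PullbackHom {
  pbh1 : hom (pb1 x) (pb1 y);
  pbh2 : hom (pb2 x) (pb2 y);
  pb_hom_eq : Arrow (fmap F pbh1) = Arrow (fmap G pbh2) }.

Lemma pullback_ob_ext (x y : pullback_ob) :
  pb1 x = pb1 y -> pb2 x = pb2 y -> x = y.
Proof.
case: x => a b e; case: y => a' b' e' /= ea eb; subst a' b'.
by rewrite (proof_irrelevance _ e e').
Qed.

Lemma pullback_hom_ext (x y : pullback_ob) (u v : pullback_hom x y) :
  pbh1 u = pbh1 v -> pbh2 u = pbh2 v -> u = v.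
Proof.
case: u => a b e; case: v => a' b' e' /= ea eb; subst a' b'.
by rewrite (proof_irrelevance _ e e').
Qed.

Definition pullback_idm (x : pullback_ob) : pullback_hom x x.
Proof.
refine (@PullbackHom x x (idm _) (idm _) _).
by rewrite !fmap_id (pb_ob_eq x).
Defined.

Definition pullback_comp (x y z : pullback_ob) (v : pullback_hom y z)
    (u : pullback_hom x y) : pullback_hom x z.
Proof.
refine (@PullbackHom x z (pbh1 v · pbh1 u) (pbh2 v · pbh2 u) _).
by rewrite !fmap_comp; apply: Arrow_comp; apply: pb_hom_eq.
Defined.

Definition pullback : category.
Proof.
refine (@Category pullback_ob pullback_hom pullback_idm pullback_comp _ _ _).
- by move=> x y u; apply: pullback_hom_ext => /=; rewrite comp1m.
- by move=> x y u; apply: pullback_hom_ext => /=; rewrite compm1.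
- by move=> x y z t w v u; apply: pullback_hom_ext => /=; rewrite compA.
Defined.

Definition pr1 : functor pullback C :=
  @Functor pullback C pb1 (fun x y u => pbh1 u)
    (fun x => eq_refl) (fun x y z v u => eq_refl).

Definition pr2 : functor pullback D :=
  @Functor pullback D pb2 (fun x y u => pbh2 u)
    (fun x => eq_refl) (fun x y z v u => eq_refl).

Lemma pullback_square : F ∘ pr1 = G ∘ pr2.
Proof. by apply: functor_ext => [x|x y u]; [apply: pb_ob_eq|apply: pb_hom_eq]. Qed.

Definition pairing (K : category) (P : functor K C) (Q : functor K D)
    (e : F ∘ P = G ∘ Q) : functor K pullback.
Proof.
refine (@Functor K pullback
  (fun A => PullbackOb (functor_eq_ob e A))
  (fun A B u => @PullbackHom (PullbackOb (functor_eq_ob e A))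
     (PullbackOb (functor_eq_ob e B)) (fmap P u) (fmap Q u)
     (functor_eq_map e u)) _ _).
- by move=> A; apply: pullback_hom_ext; rewrite /= fmap_id.
- by move=> A B L v u; apply: pullback_hom_ext; rewrite /= fmap_comp.
Defined.

End Pullback.

Arguments PullbackOb {C D E F G} pb1 pb2 pb_ob_eq.
Arguments PullbackHom {C D E F G x y} pbh1 pbh2 pb_hom_eq.
Arguments pr1 {C D E} F G.
Arguments pr2 {C D E} F G.

(* [hcomp_functor] sends a composable pair (f, g), with f first, to g after f. *)
Record double_graph := DoubleGraph {
  X0 : category;
  X1 : category;
  hsrc : functor X1 X0;
  htgt : functor X1 X0;
  hid : functor X0 X1;
  hcomp_functor : functor (pullback htgt hsrc) X1;
  hsrc_id : hsrc ∘ hid = functor_id X0;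
  htgt_id : htgt ∘ hid = functor_id X0;
  hsrc_comp : hsrc ∘ hcomp_functor = hsrc ∘ pr1 htgt hsrc;
  htgt_comp : htgt ∘ hcomp_functor = htgt ∘ pr2 htgt hsrc }.

Arguments hsrc {d}.
Arguments htgt {d}.
Arguments hid {d}.
Arguments hcomp_functor {d}.

Section DoubleGraph.
Variable X : double_graph.

Definition composable2 : category := pullback (@htgt X) (@hsrc X).
Definition composable3 : category :=
  pullback (htgt ∘ pr2 (@htgt X) (@hsrc X)) (@hsrc X).

Local Notation p1 := (pr1 (htgt ∘ pr2 (@htgt X) (@hsrc X)) (@hsrc X)).
Local Notation p2 := (pr2 (htgt ∘ pr2 (@htgt X) (@hsrc X)) (@hsrc X)).
Local Notation q1 := (pr1 (@htgt X) (@hsrc X)).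
Local Notation q2 := (pr2 (@htgt X) (@hsrc X)).

Lemma unit_src_square : @htgt X ∘ (hid ∘ hsrc) = hsrc ∘ functor_id (X1 X).
Proof. by rewrite -functor_compA htgt_id functor_comp1 functor_compr1. Qed.

Lemma unit_tgt_square : @htgt X ∘ functor_id (X1 X) = hsrc ∘ (hid ∘ htgt).
Proof. by rewrite -functor_compA hsrc_id functor_comp1 functor_compr1. Qed.

Lemma assoc_square_left : @htgt X ∘ (hcomp_functor ∘ p1) = hsrc ∘ p2.
Proof. by rewrite -functor_compA htgt_comp pullback_square. Qed.

Lemma assoc_square_tail : @htgt X ∘ (q2 ∘ p1) = hsrc ∘ p2.
Proof. by rewrite -functor_compA pullback_square. Qed.

Lemma assoc_square_right :
  @htgt X ∘ (q1 ∘ p1) = hsrc ∘ (hcomp_functor ∘ pairing assoc_square_tail).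
Proof.
rewrite -[RHS]functor_compA hsrc_comp -functor_compA pullback_square.
exact: functor_ext.
Qed.

(* (f, g, h) |-> h after (g after f), and (f, g, h) |-> (h after g) after f *)
Definition hcomp_assoc_left : functor composable3 (X1 X) :=
  hcomp_functor ∘ pairing assoc_square_left.
Definition hcomp_assoc_right : functor composable3 (X1 X) :=
  hcomp_functor ∘ pairing assoc_square_right.

End DoubleGraph.

Record double_category := DoubleCategory {
  dgraph :> double_graph;
  hcomp_id_src : hcomp_functor ∘ pairing (@unit_src_square dgraph)
                 = functor_id (X1 dgraph);
  hcomp_id_tgt : hcomp_functor ∘ pairing (@unit_tgt_square dgraph)
                 = functor_id (X1 dgraph);
  hcomp_assoc : hcomp_assoc_left dgraph = hcomp_assoc_right dgraph }.

Section DoubleCategory.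
Variable X : double_category.

Definition hcomp (g f : X1 X) (e : htgt f = hsrc g) : X1 X :=
  hcomp_functor (PullbackOb f g e).
Arguments hcomp : clear implicits.

(* For cells, [Arrow (fmap htgt a) = Arrow (fmap hsrc b)] says that the right
   side of a is the left side of b. *)
Definition hcomp_cell (f f' g g' : X1 X) (b : hom g g') (a : hom f f')
    (e : htgt f = hsrc g) (e' : htgt f' = hsrc g')
    (m : Arrow (fmap htgt a) = Arrow (fmap hsrc b)) :
    hom (hcomp g f e) (hcomp g' f' e') :=
  fmap hcomp_functor
    (PullbackHom (x := PullbackOb f g e) (y := PullbackOb f' g' e') a b m).
Arguments hcomp_cell {f f' g g'} b a e e' m.

Lemma htgt_hid (A : X0 X) : htgt (hid A) = A.
Proof. exact: functor_eq_ob (htgt_id X) A. Qed.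

Lemma hsrc_hid (A : X0 X) : hsrc (hid A) = A.
Proof. exact: functor_eq_ob (hsrc_id X) A. Qed.

Definition is_companion (f : X1 X) : Prop :=
  exists (v : hom (hsrc f) (htgt f))
         (psi : hom (hid (hsrc f)) f)
         (chi : hom f (hid (htgt f)))
         (psi_right : Arrow (fmap htgt psi) = Arrow v)
         (chi_left : Arrow (fmap hsrc chi) = Arrow v),
    Arrow (fmap hsrc psi) = Arrow (idm (hsrc f)) /\
    Arrow (fmap htgt chi) = Arrow (idm (htgt f)) /\
    Arrow (hcomp_cell chi psi (htgt_hid (hsrc f)) (eq_sym (hsrc_hid (htgt f)))
             (eq_trans psi_right (eq_sym chi_left)))
      = Arrow (idm f) /\
    chi · psi = fmap hid v.

(* Isomorphisms of X1 are the vertically invertible double cells. *)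
Definition left_precompanion (f : X1 X) : Prop :=
  exists (f' r : X1 X) (e : htgt f' = hsrc r),
    isomorphic f f' /\ is_companion (hcomp r f' e).

Definition right_precompanion (f : X1 X) : Prop :=
  exists (f' l : X1 X) (e : htgt l = hsrc f'),
    isomorphic f f' /\ is_companion (hcomp f' l e).

Definition precompanion (f : X1 X) : Prop :=
  left_precompanion f /\ right_precompanion f.

End DoubleCategory.

Arguments hcomp {X} g f e.
Arguments hcomp_cell {X f f' g g'} b a e e' m.

Definition discrete (T : Type) : category :=
  @Category T (@eq T) (@eq_refl T) (fun A B C q p => eq_trans p q)
    (fun A B p => proof_irrelevance _ _ _)
    (fun A B p => proof_irrelevance _ _ _)
    (fun A B C D r q p => proof_irrelevance _ _ _).

Section Components.
Variable C : category.

Definition connected : C -> C -> Prop :=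
  clos_refl_sym_trans C (fun A B => inhabited (hom A B)).

Definition component : Type :=
  { P : C -> Prop | exists A : C, P = connected A }.

Definition component_of (A : C) : component :=
  exist _ (connected A) (ex_intro _ A eq_refl).

Lemma component_of_eq (A B : C) : connected A B -> component_of A = component_of B.
Proof.
move=> cAB; apply: subset_eq_compat.
apply: functional_extensionality => D; apply: propositional_extensionality.
by split=> h; apply: rst_trans h => //; apply: rst_sym.
Qed.

Definition component_functor : functor C (discrete component) :=
  @Functor C (discrete component) component_of
    (fun A B u => component_of_eq (rst_step _ _ A B (inhabits u)))
    (fun A => proof_irrelevance (component_of A = component_of A) _ _)
    (fun A B E v u => proof_irrelevance (component_of A = component_of E) _ _).

End Components.

(* The n-fold fibre power C x_D ... x_D C, with the functor to D given by T on
   the last factor; consecutive factors satisfy T x_i = S x_{i+1}, and the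
   0-fold power is D. *)
Fixpoint fibre_power (C D : category) (S T : functor C D) (n : nat) :
    { E : category & functor E D } :=
  match n with
  | 0 => existT _ D (functor_id D)
  | Datatypes.S n' =>
    let E := fibre_power S T n' in
    match n' with
    | 0 => existT _ C T
    | Datatypes.S _ =>
        existT _ (pullback (projT2 E) S) (T ∘ pr2 (projT2 E) S)
    end
  end.

Section InducedFunctor.
Variables (C D D' : category) (S T : functor C D) (G : functor D D').

(* Postcomposition of S and T with G induces C x_D ... x_D C -> C x_D' ... x_D' C,
   the identity on underlying tuples. *)
Definition induced_type (n : nat) : Type :=
  { P : functor (projT1 (fibre_power S T n))
                (projT1 (fibre_power (G ∘ S) (G ∘ T) n))
  | projT2 (fibre_power (G ∘ S) (G ∘ T) n) ∘ P = G ∘ projT2 (fibre_power S T n) }.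

Lemma induced_square (A A' : category) (F : functor A D) (F' : functor A' D')
    (P : functor A A') : F' ∘ P = G ∘ F ->
  F' ∘ (P ∘ pr1 F S) = (G ∘ S) ∘ pr2 F S.
Proof. by move=> e; rewrite -functor_compA e !functor_compA pullback_square. Qed.

Lemma induced_target (A A' : category) (F : functor A D) (F' : functor A' D')
    (P : functor A A') (e : F' ∘ P = G ∘ F) :
  ((G ∘ T) ∘ pr2 F' (G ∘ S)) ∘ pairing (induced_square e)
    = G ∘ (T ∘ pr2 F S).
Proof. exact: functor_ext. Qed.

Fixpoint induced_sig (n : nat) : induced_type n :=
  match n with
  | 0 => exist _ G (eq_trans (functor_comp1 G) (eq_sym (functor_compr1 G)))
  | Datatypes.S n' =>
    match n' return induced_type n' -> induced_type (Datatypes.S n') with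
    | 0 => fun _ => exist _ (functor_id C) (functor_compr1 (G ∘ T))
    | Datatypes.S _ => fun P =>
        exist _ (pairing (induced_square (proj2_sig P)))
                (induced_target (proj2_sig P))
    end (induced_sig n')
  end.

Definition induced_functor (n : nat) := proj1_sig (induced_sig n).

End InducedFunctor.

(* The equivalences of the definition come with chosen pseudo-inverses, from
   which the fundamental bicategory is built. *)
Record weakly_globular (X : double_category) := WeaklyGlobular {
  wg_mu0 : pseudo_inverse (component_functor (X0 X));
  wg_mu : forall n : nat, 2 <= n ->
    pseudo_inverse (induced_functor (@hsrc X) htgt (component_functor (X0 X)) n) }.

Record bicategory := Bicategory {
  b0 :> Type;
  b1 : b0 -> b0 -> category;
  bid : forall a, b1 a a;
  bcomp : forall a b c, b1 b c -> b1 a b -> b1 a c;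
  bcomp2 : forall a b c (g g' : b1 b c) (f f' : b1 a b),
    hom g g' -> hom f f' -> hom (bcomp g f) (bcomp g' f');
  bcomp2_id : forall a b c (g : b1 b c) (f : b1 a b),
    bcomp2 (idm g) (idm f) = idm (bcomp g f);
  bcomp2_comp : forall a b c (g g' g'' : b1 b c) (f f' f'' : b1 a b)
      (y' : hom g' g'') (y : hom g g') (x' : hom f' f'') (x : hom f f'),
    bcomp2 (y' · y) (x' · x) = bcomp2 y' x' · bcomp2 y x;
  bassoc : forall a b c d (h : b1 c d) (g : b1 b c) (f : b1 a b),
    iso (bcomp (bcomp h g) f) (bcomp h (bcomp g f));
  blunit : forall a b (f : b1 a b), iso (bcomp (bid b) f) f;
  brunit : forall a b (f : b1 a b), iso (bcomp f (bid a)) f;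
  bassoc_natural : forall a b c d (h h' : b1 c d) (g g' : b1 b c) (f f' : b1 a b)
      (z : hom h h') (y : hom g g') (x : hom f f'),
    bassoc h' g' f' · bcomp2 (bcomp2 z y) x
      = bcomp2 z (bcomp2 y x) · bassoc h g f;
  blunit_natural : forall a b (f f' : b1 a b) (x : hom f f'),
    blunit f' · bcomp2 (idm (bid b)) x = x · blunit f;
  brunit_natural : forall a b (f f' : b1 a b) (x : hom f f'),
    brunit f' · bcomp2 x (idm (bid a)) = x · brunit f;
  bpentagon : forall a b c d e (k : b1 d e) (h : b1 c d) (g : b1 b c) (f : b1 a b),
    bcomp2 (idm k) (bassoc h g f) · bassoc k (bcomp h g) f
        · bcomp2 (bassoc k h g) (idm f)
      = bassoc k h (bcomp g f) · bassoc (bcomp k h) g f;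
  btriangle : forall a b c (g : b1 b c) (f : b1 a b),
    bcomp2 (idm g) (blunit f) · bassoc g (bid b) f
      = bcomp2 (brunit g) (idm f) }.

Arguments b1 {b} a b : rename.
Arguments bid {b} a : rename.
Arguments bcomp {b a b c} g f : rename.

Definition internal_equivalence (B : bicategory) (a b : B) (f : b1 a b) : Prop :=
  exists g : b1 b a,
    isomorphic (bid a) (bcomp g f) /\ isomorphic (bcomp f g) (bid b).

Definition eq_cell (C : category) (A B : C) (p : A = B) : hom A B := iso_of_eq p.

Lemma eq_cell_id (C : category) (A : C) (p : A = A) : eq_cell p = idm A.
Proof. by rewrite (proof_irrelevance _ p eq_refl). Qed.

Lemma eq_cell_comp (C : category) (A B D : C) (p : A = B) (q : B = D) (r : A = D) :
  eq_cell q · eq_cell p = eq_cell r.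
Proof. by subst B D; rewrite !eq_cell_id comp1m. Qed.

Lemma eq_cell_trans (C : category) (A B D : C) (p : A = B) (q : B = D) :
  eq_cell q · eq_cell p = eq_cell (eq_trans p q).
Proof. exact: eq_cell_comp. Qed.

Lemma eq_cell_natural (C : category) (A B A' B' : C) (u : hom A B) (u' : hom A' B')
    (p : A = A') (q : B = B') :
  Arrow u = Arrow u' -> u' · eq_cell p = eq_cell q · u.
Proof.
by subst A' B' => e; rewrite (Arrow_inj e) /= /eq_cell /= comp1m compm1.
Qed.

Section StrictComposition.
Variable X : double_category.

Lemma htgt_hcomp (g f : X1 X) (e : htgt f = hsrc g) : htgt (hcomp g f e) = htgt g.
Proof. exact: functor_eq_ob (htgt_comp X) (PullbackOb f g e). Qed.

Lemma hsrc_hcomp (g f : X1 X) (e : htgt f = hsrc g) : hsrc (hcomp g f e) = hsrc f.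
Proof. exact: functor_eq_ob (hsrc_comp X) (PullbackOb f g e). Qed.

Lemma hcomp_congr (g g' f f' : X1 X) (e : htgt f = hsrc g) (e' : htgt f' = hsrc g') :
  g = g' -> f = f' -> hcomp g f e = hcomp g' f' e'.
Proof. by move=> eg ef; subst g' f'; rewrite (proof_irrelevance _ e e'). Qed.

Lemma hcomp_assoc_ob (h g f : X1 X) (e : htgt f = hsrc g) (e' : htgt g = hsrc h)
    (e1 : htgt (hcomp g f e) = hsrc h) (e2 : htgt f = hsrc (hcomp h g e')) :
  hcomp (hcomp h g e') f e2 = hcomp h (hcomp g f e) e1.
Proof.
pose T := PullbackOb (F := htgt ∘ pr2 (@htgt X) (@hsrc X)) (PullbackOb f g e) h e'.
have H : hcomp h (hcomp g f e) (functor_eq_ob (assoc_square_left X) T)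
  = hcomp (hcomp h g (functor_eq_ob (assoc_square_tail X) T)) f
      (functor_eq_ob (assoc_square_right X) T) := functor_eq_ob (hcomp_assoc X) T.
rewrite (proof_irrelevance _ e1 (functor_eq_ob (assoc_square_left X) T)) H.
by apply: hcomp_congr => //; apply: hcomp_congr.
Qed.

Lemma hcomp_hid_src (f : X1 X) (A : X0 X) (e : htgt (hid A) = hsrc f) :
  hcomp f (hid A) e = f.
Proof.
have eA : A = hsrc f by rewrite -e htgt_hid.
subst A.
etransitivity; last exact: functor_eq_ob (hcomp_id_src X) f.
exact: hcomp_congr.
Qed.

Lemma hcomp_hid_tgt (f : X1 X) (A : X0 X) (e : htgt f = hsrc (hid A)) :
  hcomp (hid A) f e = f.
Proof.
have eA : A = htgt f by rewrite e hsrc_hid.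
subst A.
etransitivity; last exact: functor_eq_ob (hcomp_id_tgt X) f.
exact: hcomp_congr.
Qed.

End StrictComposition.

Section FundamentalBicategory.
Variables (X : double_category) (W : weakly_globular X).

Local Notation gamma := (component_functor (X0 X)).

Lemma vertical_unique (A B : X0 X) (u v : hom A B) : u = v.
Proof.
have E (w : hom A B) : w = iso_inv (pinv_unit (wg_mu0 W) B) ·
   (fmap (wg_mu0 W) (fmap gamma w) · pinv_unit (wg_mu0 W) A).
  have /= <- := niso_natural (pinv_unit (wg_mu0 W)) w.
  by rewrite -compA iso_homK comp1m.
rewrite (E u) (E v).
by rewrite (proof_irrelevance (gamma A = gamma B) (fmap gamma u) (fmap gamma v)).
Qed.

Lemma vertical_unique_Arrow (A B A' B' : X0 X) (u : hom A B) (v : hom A' B') :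
  A = A' -> B = B' -> Arrow u = Arrow v.
Proof. by move=> eA eB; subst A' B'; rewrite (vertical_unique u v). Qed.

Definition vertical (A B : X0 X) (e : component_of A = component_of B) : hom A B :=
  iso_inv (pinv_unit (wg_mu0 W) B)
    · (fmap (wg_mu0 W) (e : hom (gamma A) (gamma B)) · pinv_unit (wg_mu0 W) A).

Lemma component_hom (A B : X0 X) (u : hom A B) : component_of A = component_of B.
Proof. exact (fmap gamma u). Qed.

(* Strict horizontal composition of cells: their sides agree automatically. *)
Definition hcell (f f' g g' : X1 X) (b : hom g g') (a : hom f f')
    (e : htgt f = hsrc g) (e' : htgt f' = hsrc g') :
    hom (hcomp g f e) (hcomp g' f' e') :=
  hcomp_cell b a e e' (vertical_unique_Arrow _ _ e e').

Lemma hcomp_cell_irr (f f' g g' : X1 X) (b b' : hom g g') (a a' : hom f f') e e' m m' :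
  b = b' -> a = a' -> hcomp_cell b a e e' m = hcomp_cell b' a' e e' m'.
Proof. by move=> eb ea; subst b' a'; rewrite (proof_irrelevance _ m m'). Qed.

Lemma hcell_Arrow (f f' g g' : X1 X) (b : hom g g') (a : hom f f') e e' k k' :
  Arrow (hcell b a e e') = Arrow (hcell b a k k').
Proof. by rewrite (proof_irrelevance _ k e) (proof_irrelevance _ k' e'). Qed.

Lemma hcell2_Arrow (f f' g g' h h' : X1 X) (z : hom h h') (y : hom g g')
    (x : hom f f') e e' k k' i i' j j' :
  Arrow (hcell (hcell z y e e') x i i') = Arrow (hcell (hcell z y k k') x j j').
Proof.
have E := proof_irrelevance _ k e; have E' := proof_irrelevance _ k' e'.
by subst k k'; apply: hcell_Arrow.
Qed.

Lemma hcell_id (f g : X1 X) (e : htgt f = hsrc g) :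
  hcell (idm g) (idm f) e e = idm (hcomp g f e).
Proof.
rewrite /hcell /hcomp_cell -fmap_id; congr (fmap _ _).
exact: pullback_hom_ext.
Qed.

Lemma hcell_comp (f f' f'' g g' g'' : X1 X) (b' : hom g' g'') (b : hom g g')
    (a' : hom f' f'') (a : hom f f') e e' e'' :
  hcell b' a' e' e'' · hcell b a e e' = hcell (b' · b) (a' · a) e e''.
Proof.
rewrite /hcell /hcomp_cell -fmap_comp; congr (fmap _ _).
exact: pullback_hom_ext.
Qed.

Lemma hcell_eq (f f' g g' : X1 X) (q : g = g') (p : f = f') e e'
    (r : hcomp g f e = hcomp g' f' e') :
  hcell (eq_cell q) (eq_cell p) e e' = eq_cell r.
Proof.
subst f' g'; rewrite (proof_irrelevance _ e' e) in r *.
by rewrite !eq_cell_id hcell_id.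
Qed.

Lemma hcell_assoc (h h' g g' f f' : X1 X) (z : hom h h') (y : hom g g')
    (x : hom f f') e1 e1' e2 e2' e3 e3' e4 e4'
    (p : hcomp (hcomp h g e2) f e4 = hcomp h (hcomp g f e1) e3)
    (q : hcomp (hcomp h' g' e2') f' e4' = hcomp h' (hcomp g' f' e1') e3') :
  hcell z (hcell y x e1 e1') e3 e3' · eq_cell p
    = eq_cell q · hcell (hcell z y e2 e2') x e4 e4'.
Proof.
apply: eq_cell_natural.
pose P := PullbackOb (F := htgt ∘ pr2 (@htgt X) (@hsrc X)) (PullbackOb f g e1) h e2.
pose P' := PullbackOb (F := htgt ∘ pr2 (@htgt X) (@hsrc X))
  (PullbackOb f' g' e1') h' e2'.
pose u := PullbackHom (x := PullbackOb f g e1) (y := PullbackOb f' g' e1') x y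
  (vertical_unique_Arrow _ _ e1 e1').
pose U := PullbackHom (x := P) (y := P') u z (vertical_unique_Arrow _ _ e2 e2').
have H := functor_eq_map (hcomp_assoc X) U.
have El : Arrow (fmap (hcomp_assoc_left X) U) = Arrow
  (hcell z (hcell y x e1 e1') (functor_eq_ob (assoc_square_left X) P)
    (functor_eq_ob (assoc_square_left X) P')).
  by refine (f_equal (fun w => Arrow (fmap hcomp_functor w)) _); apply: pullback_hom_ext.
have Er : Arrow (fmap (hcomp_assoc_right X) U) = Arrow
  (hcell (hcell z y (functor_eq_ob (assoc_square_tail X) P)
      (functor_eq_ob (assoc_square_tail X) P')) x
    (functor_eq_ob (assoc_square_right X) P)
    (functor_eq_ob (assoc_square_right X) P')).
  refine (f_equal (fun w => Arrow (fmap hcomp_functor w)) _).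
  apply: pullback_hom_ext; first by [].
  by apply: (f_equal (fmap hcomp_functor)); apply: pullback_hom_ext.
rewrite El Er in H.
etransitivity; last (etransitivity; first (symmetry; exact: H)).
  exact: hcell2_Arrow.
exact: hcell_Arrow.
Qed.

Lemma hcell_hid_src (f f' : X1 X) (x : hom f f') (A A' : X0 X) (v : hom A A') e e'
    (p : hcomp f (hid A) e = f) (q : hcomp f' (hid A') e' = f') :
  x · eq_cell p = eq_cell q · hcell x (fmap hid v) e e'.
Proof.
have eA : A = hsrc f by rewrite -(htgt_hid A).
have eA' : A' = hsrc f' by rewrite -(htgt_hid A').
subst A A'; apply: eq_cell_natural.
rewrite (vertical_unique v (fmap hsrc x)).
etransitivity; last exact: (functor_eq_map (hcomp_id_src X) x).
have -> : Arrow (fmap (hcomp_functor ∘ pairing (unit_src_square X)) x) = Arrow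
  (hcell x (fmap hid (fmap hsrc x)) (functor_eq_ob (unit_src_square X) f)
    (functor_eq_ob (unit_src_square X) f')).
  by refine (f_equal (fun w => Arrow (fmap hcomp_functor w)) _); apply: pullback_hom_ext.
exact: hcell_Arrow.
Qed.

Lemma hcell_hid_tgt (f f' : X1 X) (x : hom f f') (A A' : X0 X) (v : hom A A') e e'
    (p : hcomp (hid A) f e = f) (q : hcomp (hid A') f' e' = f') :
  x · eq_cell p = eq_cell q · hcell (fmap hid v) x e e'.
Proof.
have eA : A = htgt f by rewrite -(hsrc_hid A).
have eA' : A' = htgt f' by rewrite -(hsrc_hid A').
subst A A'; apply: eq_cell_natural.
rewrite (vertical_unique v (fmap htgt x)).
etransitivity; last exact: (functor_eq_map (hcomp_id_tgt X) x).
have -> : Arrow (fmap (hcomp_functor ∘ pairing (unit_tgt_square X)) x) = Arrow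
  (hcell (fmap hid (fmap htgt x)) x (functor_eq_ob (unit_tgt_square X) f)
    (functor_eq_ob (unit_tgt_square X) f')).
  by refine (f_equal (fun w => Arrow (fmap hcomp_functor w)) _); apply: pullback_hom_ext.
exact: hcell_Arrow.
Qed.

(* The strictly composable pair chosen for (f, g), with its vertically
   invertible cells to f and g. *)
Section Lift.
Variables (g f : X1 X) (e : component_of (htgt f) = component_of (hsrc g)).

Let P : pullback (gamma ∘ @htgt X) (gamma ∘ @hsrc X) :=
  PullbackOb (F := gamma ∘ @htgt X) (G := gamma ∘ @hsrc X) f g e.

Definition lift2 : pullback (@htgt X) (@hsrc X) := wg_mu W (le_n 2) P.

Definition lift2_fst : iso (pb1 lift2) f :=
  functor_iso (pr1 (gamma ∘ htgt) (gamma ∘ hsrc)) (pinv_counit (wg_mu W (le_n 2)) P).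

Definition lift2_snd : iso (pb2 lift2) g :=
  functor_iso (pr2 (gamma ∘ htgt) (gamma ∘ hsrc)) (pinv_counit (wg_mu W (le_n 2)) P).

End Lift.

Record bic_arrow (a b : component (X0 X)) := BicArrow {
  bic_val :> X1 X;
  bic_src : component_of (hsrc bic_val) = a;
  bic_tgt : component_of (htgt bic_val) = b }.

(* A 2-cell is any cell with the given top and bottom: its vertical sides are
   determined, X0 being posetal. *)
Definition bic_hom (a b : component (X0 X)) : category :=
  @Category (bic_arrow a b) (fun f g => hom (bic_val f) (bic_val g))
    (fun f => idm (bic_val f)) (fun f g h y x => y · x)
    (fun f g x => comp1m x) (fun f g x => compm1 x)
    (fun f g h k z y x => compA z y x).

Definition bic_iso (a b : component (X0 X)) (f g : bic_arrow a b)
    (x : iso (bic_val f) (bic_val g)) : iso (C := bic_hom a b) f g :=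
  @Iso (bic_hom a b) f g x (iso_inv x) (iso_homK x) (iso_invK x).

Definition bic_match (a b c : component (X0 X)) (g : bic_arrow b c)
    (f : bic_arrow a b) : component_of (htgt f) = component_of (hsrc g) :=
  eq_trans (bic_tgt f) (eq_sym (bic_src g)).

Section Composite.
Variables (a b c : component (X0 X)) (g : bic_arrow b c) (f : bic_arrow a b).

Definition bic_lift := lift2 (bic_match g f).
Definition bic_fst : iso (pb1 bic_lift) f := lift2_fst (bic_match g f).
Definition bic_snd : iso (pb2 bic_lift) g := lift2_snd (bic_match g f).

Definition bic_comp_val : X1 X := hcomp (pb2 bic_lift) (pb1 bic_lift) (pb_ob_eq bic_lift).

Lemma bic_comp_src : component_of (hsrc bic_comp_val) = a.
Proof.
rewrite hsrc_hcomp -(bic_src f); exact (component_hom (fmap hsrc bic_fst)).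
Qed.

Lemma bic_comp_tgt : component_of (htgt bic_comp_val) = c.
Proof.
rewrite htgt_hcomp -(bic_tgt g); exact (component_hom (fmap htgt bic_snd)).
Qed.

Definition bic_comp : bic_arrow a c := BicArrow bic_comp_src bic_comp_tgt.

(* The cell into a composite induced by cells from a strictly composable pair *)
Definition comparison (g0 f0 : X1 X) (e : htgt f0 = hsrc g0)
    (y : hom g0 g) (x : hom f0 f) : hom (hcomp g0 f0 e) bic_comp :=
  hcell (iso_inv bic_snd · y) (iso_inv bic_fst · x) e (pb_ob_eq bic_lift).

Definition comparison_iso (g0 f0 : X1 X) (e : htgt f0 = hsrc g0)
    (y : iso g0 g) (x : iso f0 f) : iso (hcomp g0 f0 e) bic_comp.
Proof.
refine (Iso (comparison e y x)
  (hcell (iso_inv y · bic_snd) (iso_inv x · bic_fst) (pb_ob_eq bic_lift) e) _ _).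
- rewrite /comparison hcell_comp !compA.
  rewrite -(compA bic_snd) -(compA bic_fst) !iso_invK !comp1m !iso_homK.
  exact: hcell_id.
- rewrite /comparison hcell_comp !compA.
  rewrite -(compA y) -(compA x) !iso_invK !comp1m !iso_homK.
  exact: hcell_id.
Defined.

Lemma comparison_isoE (g0 f0 : X1 X) (e : htgt f0 = hsrc g0)
    (y : iso g0 g) (x : iso f0 f) :
  iso_hom (comparison_iso e y x) = comparison e y x.
Proof. by []. Qed.

Lemma comparison_hcell (g0 f0 g1 f1 : X1 X) (e : htgt f0 = hsrc g0)
    (e' : htgt f1 = hsrc g1) (y : hom g0 g) (x : hom f0 f)
    (y' : hom g1 g0) (x' : hom f1 f0) :
  comparison e y x · hcell y' x' e' e = comparison e' (y · y') (x · x').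
Proof. by rewrite /comparison hcell_comp !compA. Qed.

Lemma comparison_self : comparison (pb_ob_eq bic_lift) bic_snd bic_fst = idm bic_comp.
Proof. by rewrite /comparison !iso_homK; apply: hcell_id. Qed.

End Composite.

Definition bic_comp2 (a b c : component (X0 X)) (g g' : bic_arrow b c)
    (f f' : bic_arrow a b) (y : hom g g') (x : hom f f') :
    hom (bic_comp g f) (bic_comp g' f') :=
  hcell (iso_inv (bic_snd g' f') · (y · bic_snd g f))
        (iso_inv (bic_fst g' f') · (x · bic_fst g f)) _ _.

Lemma bic_comp2_comparison (a b c : component (X0 X)) (g g' : bic_arrow b c)
    (f f' : bic_arrow a b) (y' : hom g g') (x' : hom f f')
    (g0 f0 : X1 X) (e : htgt f0 = hsrc g0) (y : hom g0 g) (x : hom f0 f) :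
  bic_comp2 y' x' · comparison e y x = comparison e (y' · y) (x' · x).
Proof.
rewrite /bic_comp2 /comparison hcell_comp !compA.
by rewrite -(compA (bic_snd g f)) -(compA (bic_fst g f)) !iso_invK !comp1m.
Qed.

Lemma bic_comp2_id (a b c : component (X0 X)) (g : bic_arrow b c) (f : bic_arrow a b) :
  bic_comp2 (idm (bic_val g)) (idm (bic_val f)) = idm (bic_val (bic_comp g f)).
Proof. by rewrite /bic_comp2 !comp1m !iso_homK; apply: hcell_id. Qed.

Lemma bic_comp2_comp (a b c : component (X0 X)) (g g' g'' : bic_arrow b c)
    (f f' f'' : bic_arrow a b) (y' : hom g' g'') (y : hom g g')
    (x' : hom f' f'') (x : hom f f') :
  bic_comp2 (y' · y) (x' · x) = bic_comp2 y' x' · bic_comp2 y x.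
Proof.
by rewrite -[bic_comp2 y x]/(comparison _ (y · bic_snd g f) (x · bic_fst g f))
  bic_comp2_comparison -!compA.
Qed.

Lemma iso_epi (C : category) (A B D : C) (p : iso A B) (u v : hom B D) :
  u · p = v · p -> u = v.
Proof.
move=> E; rewrite -[u]compm1 -[v]compm1 -(iso_invK p) -!compA.
by rewrite E.
Qed.

Lemma iso_trans_cancel (C : category) (A A' B B' D : C) (k : iso B B') (q : iso A B)
    (p : iso A A') (u : hom D A) :
  iso_trans k (iso_trans q (iso_sym p)) · (p · u) = (k · q) · u.
Proof. by rewrite /= !compA -(compA (iso_inv p)) iso_homK comp1m. Qed.

Lemma iso_trans_cancel2 (C : category) (A A' B D : C) (q : iso A B)
    (p : iso A A') (u : hom D A) :
  iso_trans q (iso_sym p) · (p · u) = q · u.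
Proof. by rewrite /= !compA -(compA (iso_inv p)) iso_homK comp1m. Qed.

Lemma tgt_match (h g f : X1 X) (e : htgt f = hsrc g) (e' : htgt g = hsrc h) :
  htgt (hcomp g f e) = hsrc h.
Proof. by rewrite htgt_hcomp. Qed.

Lemma src_match (h g f : X1 X) (e : htgt f = hsrc g) (e' : htgt g = hsrc h) :
  htgt f = hsrc (hcomp h g e').
Proof. by rewrite hsrc_hcomp. Qed.

Section Associator.
Variables (a b c d : component (X0 X)).
Variables (h : bic_arrow c d) (g : bic_arrow b c) (f : bic_arrow a b).

(* The associator computed from a strictly composable triple (f1, g1, h1)
   isomorphic to (f, g, h) *)
Section Via.
Variables (h1 g1 f1 : X1 X) (e1 : htgt f1 = hsrc g1) (e2 : htgt g1 = hsrc h1).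
Variables (z1 : iso h1 h) (y1 : iso g1 g) (x1 : iso f1 f).

Definition assoc_via : iso (bic_val (bic_comp (bic_comp h g) f))
                           (bic_val (bic_comp h (bic_comp g f))) :=
  iso_trans
    (comparison_iso (f := bic_comp g f) (tgt_match e1 e2) z1 (comparison_iso e1 y1 x1))
    (iso_trans
      (iso_of_eq (hcomp_assoc_ob (tgt_match e1 e2) (src_match e1 e2)))
      (iso_sym (comparison_iso (g := bic_comp h g) (src_match e1 e2)
         (comparison_iso e2 z1 y1) x1))).

Lemma assoc_via_comparison (h0 g0 f0 : X1 X) (z : hom h0 h) (y : hom g0 g)
    (x : hom f0 f) k1 k2 k3 k4
    (p : hcomp (hcomp h0 g0 k2) f0 k4 = hcomp h0 (hcomp g0 f0 k1) k3) :
  assoc_via · comparison (g := bic_comp h g) k4 (comparison k2 z y) x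
    = comparison (f := bic_comp g f) k3 z (comparison k1 y x) · eq_cell p.
Proof.
have Ez : z = z1 · (iso_inv z1 · z) by rewrite -compA iso_invK comp1m.
have Ey : y = y1 · (iso_inv y1 · y) by rewrite -compA iso_invK comp1m.
have Ex : x = x1 · (iso_inv x1 · x) by rewrite -compA iso_invK comp1m.
rewrite Ez Ey Ex.
move: (iso_inv z1 · z) (iso_inv y1 · y) (iso_inv x1 · x) => z' y' x'.
rewrite -(comparison_hcell e2) -(comparison_hcell e1).
rewrite -(comparison_hcell (tgt_match e1 e2)) -(comparison_hcell (src_match e1 e2)).
rewrite [RHS]compA.
rewrite (hcell_assoc _ _ _ p (hcomp_assoc_ob (tgt_match e1 e2) (src_match e1 e2))).
rewrite -[RHS]compA.
exact: iso_trans_cancel.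
Qed.

End Via.

Let F3 : category := projT1 (fibre_power (gamma ∘ @hsrc X) (gamma ∘ @htgt X) 3).
Let pr12 : functor F3 (pullback (gamma ∘ @htgt X) (gamma ∘ @hsrc X)) := pr1 _ _.
Let pr3 : functor F3 (X1 X) := pr2 _ _.
Let P : F3 :=
  PullbackOb
    (F := (gamma ∘ @htgt X) ∘ pr2 (gamma ∘ @htgt X) (gamma ∘ @hsrc X))
    (G := gamma ∘ @hsrc X)
    (PullbackOb (F := gamma ∘ @htgt X) (G := gamma ∘ @hsrc X)
       (bic_val f) (bic_val g) (bic_match g f))
    (bic_val h) (bic_match h g).
Let mu3 := wg_mu W (le_S _ _ (le_n 2)).
Let cells : iso (induced_functor (@hsrc X) (@htgt X) gamma 3 (mu3 P)) P :=
  pinv_counit mu3 P.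

Definition lift3 : composable3 X := mu3 P.

Definition lift3_fst : iso (pb1 (pb1 lift3)) f :=
  functor_iso (C := F3) (pr1 (gamma ∘ @htgt X) (gamma ∘ @hsrc X) ∘ pr12) cells.
Definition lift3_snd : iso (pb2 (pb1 lift3)) g :=
  functor_iso (C := F3) (pr2 (gamma ∘ @htgt X) (gamma ∘ @hsrc X) ∘ pr12) cells.
Definition lift3_thd : iso (pb2 lift3) h := functor_iso (C := F3) pr3 cells.

Definition bic_assoc : iso (bic_val (bic_comp (bic_comp h g) f))
                           (bic_val (bic_comp h (bic_comp g f))) :=
  assoc_via (pb_ob_eq (pb1 lift3)) (pb_ob_eq lift3) lift3_thd lift3_snd lift3_fst.

Lemma bic_assoc_comparison (h0 g0 f0 : X1 X) (z : hom h0 h) (y : hom g0 g)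
    (x : hom f0 f) k1 k2 k3 k4
    (p : hcomp (hcomp h0 g0 k2) f0 k4 = hcomp h0 (hcomp g0 f0 k1) k3) :
  bic_assoc · comparison (g := bic_comp h g) k4 (comparison k2 z y) x
    = comparison (f := bic_comp g f) k3 z (comparison k1 y x) · eq_cell p.
Proof. exact: assoc_via_comparison. Qed.

End Associator.

Local Opaque lift2 lift2_fst lift2_snd lift3 lift3_fst lift3_snd lift3_thd
  bic_assoc.

Lemma comparison_eql (a b c : component (X0 X)) (g : bic_arrow b c) (f : bic_arrow a b)
    (g0 g1 f0 : X1 X) (q : g1 = g0) e e' (r : hcomp g1 f0 e' = hcomp g0 f0 e)
    (y : hom g0 g) (x : hom f0 f) :
  comparison e' (y · eq_cell q) x = comparison e y x · eq_cell r.
Proof.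
by rewrite -(hcell_eq q eq_refl r) comparison_hcell eq_cell_id compm1.
Qed.

Lemma comparison_eqr (a b c : component (X0 X)) (g : bic_arrow b c) (f : bic_arrow a b)
    (g0 f0 f1 : X1 X) (p : f1 = f0) e e' (r : hcomp g0 f1 e' = hcomp g0 f0 e)
    (y : hom g0 g) (x : hom f0 f) :
  comparison e' y (x · eq_cell p) = comparison e y x · eq_cell r.
Proof.
by rewrite -(hcell_eq eq_refl p r) comparison_hcell eq_cell_id compm1.
Qed.

Lemma bic_assoc_natural (a b c d : component (X0 X)) (h h' : bic_arrow c d)
    (g g' : bic_arrow b c) (f f' : bic_arrow a b)
    (z : hom h h') (y : hom g g') (x : hom f f') :
  bic_assoc h' g' f' · bic_comp2 (g := bic_comp h g) (g' := bic_comp h' g')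
      (bic_comp2 z y) x
    = bic_comp2 (f := bic_comp g f) (f' := bic_comp g' f') z (bic_comp2 y x)
      · bic_assoc h g f.
Proof.
pose e1 := pb_ob_eq (pb1 (lift3 h g f)); pose e2 := pb_ob_eq (lift3 h g f).
pose z1 := lift3_thd h g f; pose y1 := lift3_snd h g f; pose x1 := lift3_fst h g f.
refine (iso_epi (p := comparison_iso (g := bic_comp h g) (src_match e1 e2)
  (comparison_iso e2 z1 y1) x1) _); rewrite !comparison_isoE.
have p := hcomp_assoc_ob (e := e1) (e' := e2) (tgt_match e1 e2) (src_match e1 e2).
move: (iso_hom (bic_assoc h' g' f')) (@bic_assoc_comparison _ _ _ _ h' g' f') => A' HA'.
move: (iso_hom (bic_assoc h g f)) (@bic_assoc_comparison _ _ _ _ h g f) => A HA.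
rewrite !compA (HA _ _ _ _ _ _ _ _ _ _ p).
rewrite (bic_comp2_comparison (g := bic_comp h g)) bic_comp2_comparison.
rewrite (HA' _ _ _ _ _ _ _ _ _ _ p).
by rewrite -compA (bic_comp2_comparison (f := bic_comp g f)) bic_comp2_comparison.
Qed.

Lemma bic_id_component (a : component (X0 X)) : component_of (wg_mu0 W a) = a.
Proof. exact (iso_hom (pinv_counit (wg_mu0 W) a)). Qed.

Lemma bic_id_src (a : component (X0 X)) :
  component_of (hsrc (hid (wg_mu0 W a))) = a.
Proof. by rewrite hsrc_hid bic_id_component. Qed.

Lemma bic_id_tgt (a : component (X0 X)) :
  component_of (htgt (hid (wg_mu0 W a))) = a.
Proof. by rewrite htgt_hid bic_id_component. Qed.

Definition bic_id (a : component (X0 X)) : bic_arrow a a :=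
  BicArrow (bic_id_src a) (bic_id_tgt a).

Definition vertical_iso (A B : X0 X) (e : component_of A = component_of B) : iso A B :=
  Iso (vertical e) (vertical (eq_sym e)) (vertical_unique _ _) (vertical_unique _ _).

Section Unitors.
Variables (a b : component (X0 X)) (f : bic_arrow a b).

Definition lunit_cell : iso (hid (htgt f)) (bic_id b) :=
  functor_iso hid (vertical_iso (eq_trans (bic_tgt f) (eq_sym (bic_id_component b)))).

Definition runit_cell : iso (hid (hsrc f)) (bic_id a) :=
  functor_iso hid (vertical_iso (eq_trans (bic_src f) (eq_sym (bic_id_component a)))).

Definition bic_lunit : iso (bic_val (bic_comp (bic_id b) f)) f :=
  iso_trans (iso_of_eq (hcomp_hid_tgt (eq_sym (hsrc_hid (htgt f)))))
    (iso_sym (comparison_iso (eq_sym (hsrc_hid (htgt f))) lunit_cell (iso_refl f))).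

Definition bic_runit : iso (bic_val (bic_comp f (bic_id a))) f :=
  iso_trans (iso_of_eq (hcomp_hid_src (htgt_hid (hsrc f))))
    (iso_sym (comparison_iso (htgt_hid (hsrc f)) (iso_refl f) runit_cell)).

Lemma bic_lunit_comparison (f0 : X1 X) (x : hom f0 f) (A : X0 X)
    (v : hom A (wg_mu0 W b)) e (p : hcomp (hid A) f0 e = f0) :
  bic_lunit · comparison (g := bic_id b) e (fmap hid v) x = x · eq_cell p.
Proof.
have eA : component_of A = component_of (htgt f).
  by rewrite (bic_tgt f) -(bic_id_component b); apply: component_hom.
have -> : fmap hid v = lunit_cell · fmap hid (vertical eA).
  by rewrite /= -fmap_comp; congr (fmap _ _); apply: vertical_unique.
rewrite -[in LHS](comp1m x) -(comparison_hcell (eq_sym (hsrc_hid (htgt f)))).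
rewrite (hcell_hid_tgt x (vertical eA) p (hcomp_hid_tgt (eq_sym (hsrc_hid (htgt f))))).
exact: iso_trans_cancel2.
Qed.

Lemma bic_runit_comparison (f0 : X1 X) (x : hom f0 f) (A : X0 X)
    (v : hom A (wg_mu0 W a)) e (p : hcomp f0 (hid A) e = f0) :
  bic_runit · comparison (f := bic_id a) e x (fmap hid v) = x · eq_cell p.
Proof.
have eA : component_of A = component_of (hsrc f).
  by rewrite (bic_src f) -(bic_id_component a); apply: component_hom.
have -> : fmap hid v = runit_cell · fmap hid (vertical eA).
  by rewrite /= -fmap_comp; congr (fmap _ _); apply: vertical_unique.
rewrite -[in LHS](comp1m x) -(comparison_hcell (htgt_hid (hsrc f))).
rewrite (hcell_hid_src x (vertical eA) p (hcomp_hid_src (htgt_hid (hsrc f)))).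
exact: iso_trans_cancel2.
Qed.

End Unitors.

Lemma bic_lunit_natural (a b : component (X0 X)) (f f' : bic_arrow a b)
    (x : hom f f') :
  bic_lunit f' · bic_comp2 (g := bic_id b) (g' := bic_id b) (idm _) x
    = x · bic_lunit f.
Proof.
pose e := eq_sym (hsrc_hid (htgt f)).
refine (iso_epi (p := comparison_iso (g := bic_id b) e (lunit_cell f) (iso_refl _)) _); rewrite !comparison_isoE.
have [v ->] : exists v, iso_hom (lunit_cell f) = fmap hid v by eexists.
move: (iso_hom (bic_lunit f')) (@bic_lunit_comparison _ _ f') => L' HL'.
move: (iso_hom (bic_lunit f)) (@bic_lunit_comparison _ _ f) => L HL.
rewrite !compA bic_comp2_comparison comp1m.
rewrite (HL' _ _ _ _ _ (hcomp_hid_tgt e)) (HL _ _ _ _ _ (hcomp_hid_tgt e)) /=.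
by rewrite comp1m compm1.
Qed.

Lemma bic_runit_natural (a b : component (X0 X)) (f f' : bic_arrow a b)
    (x : hom f f') :
  bic_runit f' · bic_comp2 (f := bic_id a) (f' := bic_id a) x (idm _)
    = x · bic_runit f.
Proof.
pose e := htgt_hid (hsrc f).
refine (iso_epi (p := comparison_iso (f := bic_id a) e (iso_refl _) (runit_cell f)) _); rewrite !comparison_isoE.
have [v ->] : exists v, iso_hom (runit_cell f) = fmap hid v by eexists.
move: (iso_hom (bic_runit f')) (@bic_runit_comparison _ _ f') => L' HL'.
move: (iso_hom (bic_runit f)) (@bic_runit_comparison _ _ f) => L HL.
rewrite !compA bic_comp2_comparison comp1m.
rewrite (HL' _ _ _ _ _ (hcomp_hid_src e)) (HL _ _ _ _ _ (hcomp_hid_src e)) /=.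
by rewrite comp1m compm1.
Qed.

Lemma bic_triangle (a b c : component (X0 X)) (g : bic_arrow b c) (f : bic_arrow a b) :
  bic_comp2 (f := bic_comp (bic_id b) f) (idm (bic_val g)) (bic_lunit f)
      · bic_assoc g (bic_id b) f
    = bic_comp2 (g := bic_comp g (bic_id b)) (bic_runit g) (idm (bic_val f)).
Proof.
pose g0 := pb2 (bic_lift g f); pose f0 := pb1 (bic_lift g f).
have e : htgt f0 = hsrc g0 := pb_ob_eq (bic_lift g f).
have e1 : htgt f0 = hsrc (hid (htgt f0)) := eq_sym (hsrc_hid _).
have e2 : htgt (hid (htgt f0)) = hsrc g0 by rewrite htgt_hid.
have E : component_of (htgt f0) = component_of (wg_mu0 W b).
  by rewrite bic_id_component -(bic_tgt f); exact (component_hom (fmap htgt (bic_fst g f))).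
pose w : iso (hid (htgt f0)) (bic_id b) := functor_iso hid (vertical_iso E).
refine (iso_epi (p := comparison_iso (g := bic_comp g (bic_id b)) (src_match e1 e2)
  (comparison_iso e2 (bic_snd g f) w) (bic_fst g f)) _); rewrite !comparison_isoE.
have [v ->] : exists v, iso_hom w = fmap hid v by eexists.
move: (iso_hom (bic_assoc g (bic_id b) f))
  (@bic_assoc_comparison _ _ _ _ g (bic_id b) f) => A HA.
move: (iso_hom (bic_lunit f)) (@bic_lunit_comparison _ _ f) => L HL.
move: (iso_hom (bic_runit g)) (@bic_runit_comparison _ _ g) => R HR.
rewrite compA (HA _ _ _ _ _ _ _ _ _ _
  (hcomp_assoc_ob (tgt_match e1 e2) (src_match e1 e2))).
rewrite -compA !bic_comp2_comparison !comp1m.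
rewrite (HL _ _ _ _ _ (hcomp_hid_tgt e1)) (HR _ _ _ _ _ (hcomp_hid_src e2)).
rewrite (comparison_eqr (hcomp_hid_tgt e1) (e := e) (hcomp_congr _ e eq_refl (hcomp_hid_tgt e1))).
rewrite (comparison_eql (hcomp_hid_src e2) (e := e) (hcomp_congr _ e (hcomp_hid_src e2) eq_refl)).
by rewrite compA; congr (_ · _); apply: eq_cell_comp.
Qed.

Section FourfoldLift.
Variables (a b c d e : component (X0 X)).
Variables (k : bic_arrow d e) (h : bic_arrow c d) (g : bic_arrow b c)
  (f : bic_arrow a b).

Let F4 : category := projT1 (fibre_power (gamma ∘ @hsrc X) (gamma ∘ @htgt X) 4).
Let F3 : category := projT1 (fibre_power (gamma ∘ @hsrc X) (gamma ∘ @htgt X) 3).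
Let F2 : category := projT1 (fibre_power (gamma ∘ @hsrc X) (gamma ∘ @htgt X) 2).
Let r3 : functor F4 F3 := pr1 _ _.
Let r2 : functor F3 F2 := pr1 _ _.
Let s4 : functor F4 (X1 X) := pr2 _ _.
Let s3 : functor F3 (X1 X) := pr2 _ _.
Let s2 : functor F2 (X1 X) := pr2 _ _.
Let s1 : functor F2 (X1 X) := pr1 _ _.
Let P2 : F2 := PullbackOb (F := gamma ∘ @htgt X) (G := gamma ∘ @hsrc X)
  (bic_val f) (bic_val g) (bic_match g f).
Let P3 : F3 := PullbackOb (C := F2) (F := (gamma ∘ @htgt X) ∘ s2)
  (G := gamma ∘ @hsrc X) P2 (bic_val h) (bic_match h g).
Let P : F4 := PullbackOb (C := F3) (F := (gamma ∘ @htgt X) ∘ s3)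
  (G := gamma ∘ @hsrc X) P3 (bic_val k) (bic_match k h).
Let mu4 := wg_mu W (le_S _ _ (le_S _ _ (le_n 2))).
Let L := mu4 P.
Let cells : iso (induced_functor (@hsrc X) (@htgt X) gamma 4 L) P :=
  pinv_counit mu4 P.

Lemma lift4 : exists k0 h0 g0 f0 : X1 X,
  htgt f0 = hsrc g0 /\ htgt g0 = hsrc h0 /\ htgt h0 = hsrc k0 /\
  isomorphic f0 f /\ isomorphic g0 g /\ isomorphic h0 h /\ isomorphic k0 k.
Proof.
exists (pb2 L), (pb2 (pb1 L)), (pb2 (pb1 (pb1 L))), (pb1 (pb1 (pb1 L))).
split; first exact: (pb_ob_eq (pb1 (pb1 L))).
split; first exact: (pb_ob_eq (pb1 L)).
split; first exact: (pb_ob_eq L).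
split; first exact (inhabits (functor_iso (C := F4) (s1 ∘ (r2 ∘ r3)) cells)).
split; first exact (inhabits (functor_iso (C := F4) (s2 ∘ (r2 ∘ r3)) cells)).
split; first exact (inhabits (functor_iso (C := F4) (s3 ∘ r3) cells)).
exact (inhabits (functor_iso (C := F4) s4 cells)).
Qed.

End FourfoldLift.

Lemma bic_pentagon (a b c d e : component (X0 X)) (k : bic_arrow d e)
    (h : bic_arrow c d) (g : bic_arrow b c) (f : bic_arrow a b) :
  bic_comp2 (f := bic_comp (bic_comp h g) f) (f' := bic_comp h (bic_comp g f))
      (idm (bic_val k)) (bic_assoc h g f)
    · bic_assoc k (bic_comp h g) f
    · bic_comp2 (g := bic_comp (bic_comp k h) g) (g' := bic_comp k (bic_comp h g))
        (bic_assoc k h g) (idm (bic_val f))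
    = bic_assoc k h (bic_comp g f) · bic_assoc (bic_comp k h) g f.
Proof.
have [k0 [h0 [g0 [f0 [e1 [e2 [e3 [[x] [[y] [[z] [w]]]]]]]]]]] := lift4 k h g f.
have e12 := src_match e1 e2.
have e23 := src_match e2 e3.
have e12' := tgt_match e1 e2.
have e23' := tgt_match e2 e3.
have i1 : htgt f0 = hsrc (hcomp (hcomp k0 h0 e3) g0 e23) by rewrite hsrc_hcomp.
have i2 : htgt f0 = hsrc (hcomp k0 (hcomp h0 g0 e2) e23') by rewrite !hsrc_hcomp.
have i3 : htgt (hcomp (hcomp h0 g0 e2) f0 e12) = hsrc k0 by rewrite !htgt_hcomp.
have i4 : htgt (hcomp h0 (hcomp g0 f0 e1) e12') = hsrc k0 by rewrite !htgt_hcomp.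
have i5 : htgt (hcomp g0 f0 e1) = hsrc (hcomp k0 h0 e3) by rewrite htgt_hcomp hsrc_hcomp.
refine (iso_epi (p := comparison_iso (g := bic_comp (bic_comp k h) g) i1
  (comparison_iso (g := bic_comp k h) e23 (comparison_iso e3 w z) y) x) _); rewrite !comparison_isoE.
move: (iso_hom (bic_assoc k h g)) (@bic_assoc_comparison _ _ _ _ k h g) => A1 H1.
move: (iso_hom (bic_assoc k (bic_comp h g) f))
  (@bic_assoc_comparison _ _ _ _ k (bic_comp h g) f) => A2 H2.
move: (iso_hom (bic_assoc h g f)) (@bic_assoc_comparison _ _ _ _ h g f) => A3 H3.
move: (iso_hom (bic_assoc (bic_comp k h) g f))
  (@bic_assoc_comparison _ _ _ _ (bic_comp k h) g f) => A4 H4.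
move: (iso_hom (bic_assoc k h (bic_comp g f)))
  (@bic_assoc_comparison _ _ _ _ k h (bic_comp g f)) => A5 H5.
rewrite !compA bic_comp2_comparison comp1m.
rewrite (H1 _ _ _ _ _ _ _ _ _ _ (hcomp_assoc_ob e23' e23)).
rewrite (comparison_eql (g := bic_comp k (bic_comp h g)) (hcomp_assoc_ob e23' e23) (e := i2)
  (hcomp_congr _ _ (hcomp_assoc_ob e23' e23) eq_refl)).
rewrite -(compA A2) (H2 _ _ _ _ _ _ _ _ _ _ (hcomp_assoc_ob i3 i2)).
rewrite (H4 _ _ _ _ _ _ _ _ _ _ (hcomp_assoc_ob i5 i1)).
rewrite -(compA A5) (H5 _ _ _ _ _ _ _ _ _ _ (hcomp_assoc_ob i4 i5)).
rewrite -!compA bic_comp2_comparison comp1m.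
rewrite (H3 _ _ _ _ _ _ _ _ _ _ (hcomp_assoc_ob e12' e12)).
rewrite (comparison_eqr (f := bic_comp h (bic_comp g f)) (hcomp_assoc_ob e12' e12) (e := i4)
  (hcomp_congr _ _ eq_refl (hcomp_assoc_ob e12' e12))).
rewrite !compA; congr (_ · _).
by rewrite !eq_cell_trans; congr (eq_cell _); apply: proof_irrelevance.
Qed.

Definition Bic : bicategory.
Proof.
refine (@Bicategory (component (X0 X)) bic_hom bic_id bic_comp
  (fun a b c g g' f f' y x => bic_comp2 y x)
  _ _
  (fun a b c d h g f => bic_iso (bic_assoc h g f))
  (fun a b f => bic_iso (bic_lunit f))
  (fun a b f => bic_iso (bic_runit f))
  _ _ _ _ _).
- exact bic_comp2_id.
- exact bic_comp2_comp.
- exact bic_assoc_natural.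
- exact bic_lunit_natural.
- exact bic_runit_natural.
- exact bic_pentagon.
- exact bic_triangle.
Defined.

Definition bic_of (f : X1 X) :
    bic_hom (component_of (hsrc f)) (component_of (htgt f)) :=
  BicArrow (bic_val := f) eq_refl eq_refl.

End FundamentalBicategory.

(* Main.v *)
(** In a weakly globular double category every vertical arrow is invertible and
    unique between its endpoints, so the companions are exactly the horizontal
    arrows isomorphic in [X1] to a horizontal identity. Hence a left (right)
    precompanion is an arrow with a left (right) pseudo-inverse in [Bic W], and in
    any bicategory an arrow with both is an equivalence. *)

From Stdlib Require Import ssreflect.
Require Import Defs.

Set Implicit Arguments.
Unset Strict Implicit.
Unset Printing Implicit Defensive.

Lemma isomorphic_sym (C : category) (A B : C) : isomorphic A B -> isomorphic B A.
Proof. by case=> i; exists; apply: iso_sym. Qed.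

Lemma isomorphic_trans (C : category) (A B D : C) :
  isomorphic A B -> isomorphic B D -> isomorphic A D.
Proof. by case=> i [j]; exists; apply: iso_trans j i. Qed.

(** Converse of [eq_cell_natural]: once the endpoints are identified, both [eq_cell]s are
    identities. *)
Lemma Arrow_of_eq_cell (C : category) (A B A' B' : C) (u : hom A B) (u' : hom A' B')
    (p : A = A') (q : B = B') :
  u' · eq_cell p = eq_cell q · u -> Arrow u = Arrow u'.
Proof. by subst A' B'; rewrite /eq_cell /= comp1m compm1 => ->. Qed.

Section Bicategory.
Variable B : bicategory.

Lemma isomorphic_bcomp (a b c : B) (g g' : b1 b c) (f f' : b1 a b) :
  isomorphic g g' -> isomorphic f f' -> isomorphic (bcomp g f) (bcomp g' f').
Proof.
case=> j [i]; exists.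
apply: (Iso (bcomp2 j i) (bcomp2 (iso_inv j) (iso_inv i))).
- by rewrite -bcomp2_comp !iso_homK bcomp2_id.
- by rewrite -bcomp2_comp !iso_invK bcomp2_id.
Qed.

(** The two one-sided inverses agree, by [r ≅ r∘1 ≅ r∘(f∘l) ≅ (r∘f)∘l ≅ 1∘l ≅ l], so [r] also
    inverts [f] on the right. *)
Lemma internal_equivalence_of_sided (a b : B) (f : b1 a b) (r l : b1 b a) :
  isomorphic (bid a) (bcomp r f) -> isomorphic (bcomp f l) (bid b) ->
  internal_equivalence f.
Proof.
move=> rf fl; exists r; split=> //.
have rl : isomorphic r l.
  apply: isomorphic_trans (isomorphic_sym (inhabits (brunit r))) _.
  apply: isomorphic_trans
    (isomorphic_bcomp (inhabits (iso_refl r)) (isomorphic_sym fl)) _.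
  apply: isomorphic_trans (isomorphic_sym (inhabits (bassoc r f l))) _.
  apply: isomorphic_trans
    (isomorphic_bcomp (isomorphic_sym rf) (inhabits (iso_refl l))) _.
  exact: inhabits (blunit l).
exact: isomorphic_trans (isomorphic_bcomp (inhabits (iso_refl f)) rl) fl.
Qed.

End Bicategory.

Section WeaklyGlobular.
Variables (X : double_category) (W : weakly_globular X).

Lemma isomorphic_component_src (f g : X1 X) :
  isomorphic f g -> component_of (hsrc f) = component_of (hsrc g).
Proof. by case=> i; apply: component_hom (fmap hsrc i). Qed.

Lemma isomorphic_component_tgt (f g : X1 X) :
  isomorphic f g -> component_of (htgt f) = component_of (htgt g).
Proof. by case=> i; apply: component_hom (fmap htgt i). Qed.

Lemma isomorphic_hid (A B : X0 X) :
  component_of A = component_of B -> isomorphic (hid A) (hid B).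
Proof. by move=> e; exists; apply: functor_iso (vertical_iso W e). Qed.

(* Interchange for the pasting with upper row [hid u], [chi] and lower row
   [psi · hid v], [hid (htgt f)], where [u] is inverse to [v]. *)
Lemma hcell_binding (f : X1 X) (psi : hom (hid (hsrc f)) f)
    (chi : hom f (hid (htgt f))) (v : hom (htgt f) (hsrc f)) e e' :
  Arrow (hcell W chi psi e e') = Arrow (psi · fmap hid v · chi).
Proof.
have p := hcomp_hid_src e; have q := hcomp_hid_tgt e'.
have m : htgt (hid (htgt f)) = hsrc (hid (htgt f)) by rewrite htgt_hid hsrc_hid.
have u : hom (hsrc f) (htgt f).
  apply: (vertical W); exact: eq_sym (component_hom v).
have s := hcomp_hid_src m.
apply: (@Arrow_of_eq_cell _ _ _ _ _ _ _ p q).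
(* The unit laws pad [chi] and [psi · hid v] to full rows; [hcell_comp] stacks them, and
   [hid v · hid u] in the left column is an identity. *)
rewrite compA (hcell_hid_src W chi u p s) -compA.
rewrite (hcell_hid_tgt W (psi · fmap hid v) (idm _) s q) compA hcell_comp.
rewrite fmap_id comp1m compA -fmap_comp.
by rewrite (vertical_unique W (v · u) (idm _)) fmap_id compm1.
Qed.

(** With [w] the vertical inverse of [v], the cell [hid w · chi] inverts [psi]: one law comes from
    [chi · psi = hid v], the other from the horizontal law read through [hcell_binding]. *)
Lemma is_companion_iff (f : X1 X) :
  is_companion f <-> exists A : X0 X, isomorphic (hid A) f.
Proof.
split.
  case=> v [psi [chi [p [q [_ [_ [binding pasting]]]]]]].
  exists (hsrc f).
  pose w := vertical W (eq_sym (component_hom v)).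
  exists; apply: (Iso psi (fmap hid w · chi)).
    rewrite compA pasting -fmap_comp.
    by rewrite (vertical_unique W (w · v) (idm _)) fmap_id.
  apply: Arrow_inj; rewrite -compA.
  rewrite -binding; symmetry.
  rewrite -(hcell_binding psi chi w (htgt_hid (hsrc f)) (eq_sym (hsrc_hid (htgt f)))).
  by congr Arrow; apply: hcomp_cell_irr.
case=> A [x].
have es : component_of A = component_of (hsrc f).
  by rewrite -(isomorphic_component_src (inhabits x)) hsrc_hid.
have et : component_of A = component_of (htgt f).
  by rewrite -(isomorphic_component_tgt (inhabits x)) htgt_hid.
pose v := vertical W (eq_trans (eq_sym es) et).
pose w := vertical W (eq_trans (eq_sym et) es).
(* The isomorphism and its inverse, moved along vertical arrows so that the identities sit at the
   two ends of [f]. *)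
pose psi := x · fmap hid (vertical W (eq_sym es)).
pose chi := fmap hid (vertical W et) · iso_inv x.
have p : Arrow (fmap htgt psi) = Arrow v.
  by apply: (vertical_unique_Arrow W) => //; apply: htgt_hid.
have q : Arrow (fmap hsrc chi) = Arrow v.
  by apply: (vertical_unique_Arrow W) => //; apply: hsrc_hid.
exists v, psi, chi, p, q; split; [|split; [|split]].
- by apply: (vertical_unique_Arrow W) => //; apply: hsrc_hid.
- by apply: (vertical_unique_Arrow W) => //; apply: htgt_hid.
- transitivity (Arrow (psi · fmap hid w · chi)); last first.
    congr Arrow; rewrite /psi /chi !compA -(compA (fmap hid w)) -fmap_comp.
    rewrite -(compA (fmap hid _)) -fmap_comp.
    by rewrite (vertical_unique W (_ · (w · _)) (idm _)) fmap_id comp1m iso_invK.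
  rewrite -(hcell_binding psi chi w (htgt_hid (hsrc f)) (eq_sym (hsrc_hid (htgt f)))).
  by congr Arrow; apply: hcomp_cell_irr.
- rewrite /chi /psi !compA -(compA (iso_inv x)) iso_homK comp1m -fmap_comp.
  by congr fmap; apply: (vertical_unique W).
Qed.

Lemma isomorphic_bic (a b : component (X0 X)) (f g : bic_arrow a b) :
  isomorphic (C := bic_hom a b) f g <-> isomorphic (bic_val f) (bic_val g).
Proof.
split; case=> i; last by exists; apply: bic_iso.
by exists; apply: (Iso (C := X1 X) (iso_hom i) (iso_inv i) (iso_homK i) (iso_invK i)).
Qed.

(** [comparison_iso] identifies the strict composite of [r] and [f'] with the composite in [Bic W],
    and identities on objects of one component are isomorphic. *)
Lemma left_precompanion_iff (a b : component (X0 X)) (f : bic_arrow a b) :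
  left_precompanion f <->
  exists g : bic_arrow b a, isomorphic (bic_val (bic_id W a)) (bic_comp W g f).
Proof.
split.
  case=> f' [r [e [ff' /is_companion_iff [A Arf]]]].
  have sr : component_of (hsrc r) = b.
    by rewrite -(bic_tgt f) (isomorphic_component_tgt ff') e.
  have sA : component_of A = a.
    rewrite -(bic_src f) (isomorphic_component_src ff') -(hsrc_hcomp e).
    by rewrite -(isomorphic_component_src Arf) hsrc_hid.
  (* A companion starts and ends in one component, that of [A], so [r] returns to [a]. *)
  have tr : component_of (htgt r) = a.
    rewrite -sA -(htgt_hcomp e).
    by rewrite -(isomorphic_component_tgt Arf) htgt_hid.
  exists (BicArrow sr tr).
  apply: isomorphic_trans (isomorphic_hid (eq_trans (bic_id_component W a) (eq_sym sA))) _.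
  apply: isomorphic_trans Arf _.
  case: ff' => i.
  exact: inhabits (comparison_iso W (g := BicArrow sr tr) e (iso_refl r) (iso_sym i)).
case=> g gf.
(* Composition in [Bic W] is strict composition of the chosen lift, which therefore supplies [f']
   and [r]. *)
exists (pb1 (bic_lift W g f)), (pb2 (bic_lift W g f)), (pb_ob_eq (bic_lift W g f)).
split; first exact: inhabits (iso_sym (bic_fst W g f)).
by apply/is_companion_iff; exists (wg_mu0 W a).
Qed.

Lemma right_precompanion_iff (a b : component (X0 X)) (f : bic_arrow a b) :
  right_precompanion f <->
  exists g : bic_arrow b a, isomorphic (bic_val (bic_comp W f g)) (bic_id W b).
Proof.
split.
  case=> f' [l [e [ff' /is_companion_iff [A Afl]]]].
  have tl : component_of (htgt l) = a.
    by rewrite -(bic_src f) (isomorphic_component_src ff') e.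
  have tA : component_of A = b.
    rewrite -(bic_tgt f) (isomorphic_component_tgt ff') -(htgt_hcomp e).
    by rewrite -(isomorphic_component_tgt Afl) htgt_hid.
  have sl : component_of (hsrc l) = b.
    rewrite -tA -(hsrc_hcomp e).
    by rewrite -(isomorphic_component_src Afl) hsrc_hid.
  exists (BicArrow sl tl); apply: isomorphic_sym.
  apply: isomorphic_trans (isomorphic_hid (eq_trans (bic_id_component W b) (eq_sym tA))) _.
  apply: isomorphic_trans Afl _.
  case: ff' => i.
  exact: inhabits (comparison_iso W (f := BicArrow sl tl) e (iso_sym i) (iso_refl l)).
case=> g fg.
(* Here [f] is the outer factor, so its replacement is the second component of the lift. *)
exists (pb2 (bic_lift W f g)), (pb1 (bic_lift W f g)), (pb_ob_eq (bic_lift W f g)).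
split; first exact: inhabits (iso_sym (bic_snd W f g)).
by apply/is_companion_iff; exists (wg_mu0 W b); apply: isomorphic_sym.
Qed.

End WeaklyGlobular.

Theorem proposition3p17 (X : double_category) (W : weakly_globular X) (f : X1 X) :
  internal_equivalence (B := Bic W) (bic_of f) <-> precompanion f.
Proof.
split.
  case=> g [/isomorphic_bic gf /isomorphic_bic fg].
  by split; [apply/(left_precompanion_iff W (bic_of f))
            |apply/(right_precompanion_iff W (bic_of f))]; exists g.
(* The one-sided inverses [r] and [l] obtained here are a priori unrelated. *)
case=> /(left_precompanion_iff W (bic_of f)) [r /isomorphic_bic rf].
move=> /(right_precompanion_iff W (bic_of f)) [l /isomorphic_bic fl].
exact: (internal_equivalence_of_sided (B := Bic W) rf fl).
Qed.
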